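(* In the concrete model with $M=2k$ and all $b_j\neq0$, suppose the angles $\theta_1,\dots,\theta_{2k}\in\mathbb{C}$ satisfy, with $\theta_0=\theta_{-1}=0$, $$\sin\theta_{2j}=\frac{b_{2j}}{\cos\theta_{2j-2}},\qquad \sin\theta_{2j-1}=\frac{b_{2j-1}}{\cos\theta_{2j-2}\cos\theta_{2j-3}\cos\theta_{2j}}\qquad(1\le j\le k),$$ with all $\cos\theta_j\neq0$, and suppose the couplings are chosen as $\beta_3=\frac{1}{1-b_2^2}$, $\beta_5=\frac{1}{1-b_2^2-b_4^2}$ with the remaining $\beta_{2m+1}$ ($m\ge3$) given by the recursion of the concrete model. Then $\beta_{2j-1}=\frac{1}{\cos^2\theta_{2j-4}\cos^2\theta_{2j-2}}$ for $2\le j\le k$, and the transfer matrix at $u=-1$ factorizes as $T_{2k}(-1)=\mathcal{V}_{2k}$.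
   Context: Concrete model. Fix an integer $M\ge1$ and complex numbers $b_1,\dots,b_M$. Let $h_1,\dots,h_M$ be elements of a unital associative complex algebra satisfying $h_m^2=b_m^2\mathbb{1}$, $h_mh_{m+1}=-h_{m+1}h_m$, $h_mh_{m+2}=-h_{m+2}h_m$, and $h_mh_l=h_lh_m$ for $|l-m|>2$ (e.g. $h_m=b_m\sigma^z_m\sigma^z_{m+1}\sigma^x_{m+2}$ on a spin chain). Set $h_j:=0$, $b_j:=0$ for $j\le 0$ or $j>M$. Let $\beta_3,\beta_5$ be arbitrary complex numbers and define $\beta_{2m+1}:=\beta_{2m-1}/(b_{2m-4}^2\beta_{2m-3}-b_{2m}^2\beta_{2m-1}+1)$ for $m\ge3$ (denominators assumed nonzero). For $2\le m\le\lfloor M/2\rfloor$ put $\bar h_{2m+1}:=\beta_{2m-1}h_{2m-2}h_{2m-3}h_{2m}$ and $\bar b_{2m+1}:=\beta_{2m-1}b_{2m-2}b_{2m-3}b_{2m}$ (so $\bar h_{2m+1}^2=\bar b_{2m+1}^2\mathbb{1}$); otherwise $\bar h_{2m+1}:=0$, $\bar b_{2m+1}:=0$. For $1\le j\le M$, the model of size $j$ (same couplings) has frustration graph $G_j$ with vertices $h_1,\dots,h_j$ and $\bar h_{2m+1}$ for $2\le m\le\lfloor j/2\rfloor$, and edges $h_i\sim h_l$ iff $|i-l|\in\{1,2\}$; $\bar h_{2m-1}\sim h_l$ iff $l\in\{2m-7,2m-5,2m-3,2m-1,2m-2,2m\}$; $\bar h_{2m-1}\sim\bar h_{2m'-1}$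 iff $|m-m'|=1$ (adjacent vertices anticommute, non-adjacent distinct ones commute). Charges: $Q_j^{(k)}:=\sum_{S}\prod_{v\in S}v$, the sum over independent sets $S$ of $G_j$ of size $k$ ($Q_j^{(0)}=\mathbb{1}$). Hamiltonian $H_j:=Q_j^{(1)}=\sum_{l=1}^j h_l+\sum_{m=2}^{\lfloor j/2\rfloor}\beta_{2m-1}h_{2m-2}h_{2m-3}h_{2m}$. Transfer matrix $T_j(u):=\sum_{k\ge0}(-u)^kQ_j^{(k)}$ for $u\in\mathbb{C}$, with $T_j(u):=\mathbb{1}$ for $j\le 0$. Circuit: local gates $g_j:=\cos(\theta_j/2)\mathbb{1}+\sin(\theta_j/2)\,b_j^{-1}h_j$; $G_{2k}:=(g_2g_1)(g_4g_3)\cdots(g_{2k}g_{2k-1})$, $G_{2k}^{\top}:=(g_{2k-1}g_{2k})\cdots(g_3g_4)(g_1g_2)$ (reversed order); $\mathcal{V}_{2k}:=G_{2k}G_{2k}^{\top}$. *)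

(* Defs.v *)
From HB Require Import structures.
From mathcomp Require Import all_boot all_order all_algebra.
From mathcomp Require Import all_classical all_reals all_analysis.
From mathcomp Require Import complex.
Set Implicit Arguments. Unset Strict Implicit. Unset Printing Implicit Defensive.
Import Order.TTheory GRing.Theory Num.Theory.
Local Open Scope ring_scope.

Definition Cexp (R : realType) (z : R[i]) : R[i] :=
  (expR (@complex.Re R z))%:C%C * ((cos (@complex.Im R z))%:C%C + 'i%C * (sin (@complex.Im R z))%:C%C).
Definition Ccos (R : realType) (z : R[i]) : R[i] :=
  (Cexp ('i%C * z) + Cexp (- ('i%C * z))) / 2.
Definition Csin (R : realType) (z : R[i]) : R[i] :=
  (Cexp ('i%C * z) - Cexp (- ('i%C * z))) / (2 * 'i%C).

(* betam b b3 b5 m = beta_{2m+1}:  beta_3 = b3, beta_5 = b5 and for m >= 3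
   beta_{2m+1} = beta_{2m-1} / (b_{2m-4}^2 beta_{2m-3} - b_{2m}^2 beta_{2m-1} + 1). *)
Fixpoint betam (C : fieldType) (b : nat -> C) (b3 b5 : C) (m : nat) : C :=
  match m with
  | 0 => 0
  | 1 => b3
  | 2 => b5
  | S ((S ((S p) as q1)) as q2) =>
      betam b b3 b5 q2 /
        (b (p.+3.*2 - 4)%N ^+ 2 * betam b b3 b5 q1
         - b p.+3.*2 ^+ 2 * betam b b3 b5 q2 + 1)
  end.

(* beta n = beta_n for odd n (n = 2m+1). *)
Definition beta (C : fieldType) (b : nat -> C) (b3 b5 : C) (n : nat) : C :=
  betam b b3 b5 n./2.

(* VH l = h_l ;  VB n = \bar h_n (n = 2m+1, 2 <= m <= floor(j/2)). *)
Inductive vtx := VH of nat | VB of nat.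

Definition adj (v w : vtx) : bool :=
  match v, w with
  | VH i, VH l => [|| i + 1 == l, l + 1 == i, i + 2 == l | l + 2 == i]
  | VB n, VH l | VH l, VB n =>
      [|| l + 6 == n, l + 4 == n, l + 2 == n, l == n, l + 1 == n | l == n + 1]
  | VB n, VB n' => (n + 2 == n') || (n' + 2 == n)
  end.

Definition verts (j : nat) : seq vtx :=
  [seq VH l | l <- iota 1 j] ++ [seq VB (m.*2.+1) | m <- iota 2 (j./2).-1].

Definition vnth (j : nat) (i : nat) : vtx := nth (VH 0) (verts j) i.

Definition vop (C : fieldType) (A : algType C) (h : nat -> A) (b : nat -> C)
  (b3 b5 : C) (v : vtx) : A :=
  match v with
  | VH l => h l
  | VB n => beta b b3 b5 (n - 2)%N *: (h (n - 3)%N * h (n - 4)%N * h (n - 1)%N)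
  end.

Definition indep (j : nat) (S : {set 'I_(size (verts j))}) : bool :=
  [forall x in S, forall y in S, ~~ adj (vnth j x) (vnth j y)].

Definition Qch (C : fieldType) (A : algType C) (h : nat -> A) (b : nat -> C)
  (b3 b5 : C) (j k : nat) : A :=
  \sum_(S : {set 'I_(size (verts j))} | indep S && (#|S| == k))
     \prod_(i in S) vop h b b3 b5 (vnth j i).

(* transfer matrix T_j(u) = sum_k (-u)^k Q_j^{(k)} (Q_j^{(k)} = 0 for k > #vertices) *)
Definition Tmat (C : fieldType) (A : algType C) (h : nat -> A) (b : nat -> C)
  (b3 b5 : C) (j : nat) (u : C) : A :=
  \sum_(k < (size (verts j)).+1) (- u) ^+ k *: Qch h b b3 b5 j k.

Definition gate (R : realType) (A : algType R[i]) (h : nat -> A) (b : nat -> R[i])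
  (theta : nat -> R[i]) (j : nat) : A :=
  Ccos (theta j / 2) *: 1 + (Csin (theta j / 2) * (b j)^-1) *: h j.

Definition Gcirc (R : realType) (A : algType R[i]) (h : nat -> A) (b : nat -> R[i])
  (theta : nat -> R[i]) (k : nat) : A :=
  \prod_(i < k) (gate h b theta (i.*2 + 2) * gate h b theta (i.*2 + 1)).

Definition GcircT (R : realType) (A : algType R[i]) (h : nat -> A) (b : nat -> R[i])
  (theta : nat -> R[i]) (k : nat) : A :=
  \prod_(i < k) (gate h b theta ((k - i).*2 - 1)%N * gate h b theta ((k - i).*2)).

Definition Vcirc (R : realType) (A : algType R[i]) (h : nat -> A) (b : nat -> R[i])
  (theta : nat -> R[i]) (k : nat) : A :=
  Gcirc h b theta k * GcircT h b theta k.

(* Main.v *)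
(* T_{2j} and V_{2j} satisfy the same recursion in j. On the graph side, h_{2j+3}, h_{2j+4} and
   the last composite vertex form a clique in G_{2j+4}, so removing them (and the neighbourhood
   of the one chosen, if any) expresses the sum over independent sets through T_{2j+2}, T_{2j},
   T_{2j-2} and T_{2j-4}. On the circuit side, the innermost layer is conjugated outwards:
   g_j X g_j is X g_j^2 if h_j commutes with X, and cos(theta_j) X if they anticommute; after one
   layer all newly created operators commute with the remaining gates, and the constraints on
   the angles turn the resulting coefficients into those of the graph recursion. *)

Require Import Defs.
From HB Require Import structures.
From mathcomp Require Import all_boot all_order all_algebra.
From mathcomp Require Import zify ring.
Import Order.TTheory GRing.Theory Num.Theory.
Local Open Scope ring_scope.
Set Implicit Arguments. Unset Strict Implicit. Unset Printing Implicit Defensive.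

(** * Ordered independence polynomials over a noncommutative ring *)

Section IndependencePolynomial.
Variables (T : eqType) (A : pzRingType) (f : T -> A) (e : rel T).

(* The sum over independent sets, all of whose elements satisfy P, of the ordered products of f. *)
Fixpoint ipoly (P : pred T) (s : seq T) : A :=
  if s is v :: s' then
    ipoly P s' + (if P v then f v * ipoly (fun w => P w && ~~ e v w) s' else 0)
  else 1.

Lemma eq_ipoly P Q s : P =1 Q -> ipoly P s = ipoly Q s.
Proof.
elim: s P Q => //= v s IH P Q PQ.
by rewrite (IH P Q) // PQ (IH (fun w => P w && _) (fun w => Q w && ~~ e v w)) // => w; rewrite PQ.
Qed.

Lemma ipoly_filter P Q s :
  ipoly (fun w => P w && Q w) s = ipoly Q (filter P s).
Proof.
elim: s P Q => //= v s IH P Q; rewrite IH; case: (P v) => /=; last by rewrite addr0.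
congr (_ + _); case: (Q v) => //; congr (_ * _).
by rewrite -IH; apply: eq_ipoly => w; rewrite andbA.
Qed.

Lemma ipoly_cons v s :
  ipoly predT (v :: s) =
  ipoly predT s + f v * ipoly predT [seq w <- s | ~~ e v w].
Proof.
rewrite /= -ipoly_filter; congr (_ + _ * _).
by apply: eq_ipoly => w; rewrite andbT.
Qed.

Hypothesis e_sym : symmetric e.
Hypothesis e_irr : irreflexive e.

(** Induction on the list, splitting the sets by whether they contain [ord0]; [up] and [down]
    translate between subsets of the tail and of the whole list. A chosen head stands leftmost in
    its product, and [P] passes the ban on its neighbours to the tail. *)
Lemma ipoly_sum_indep (v0 : T) P s :
  \sum_(S : {set 'I_(size s)} |
        [forall x in S, forall y in S, ~~ e (nth v0 s x) (nth v0 s y)]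
        && [forall x in S, P (nth v0 s x)])
     \prod_(i in S) f (nth v0 s i) = ipoly P s.
Proof.
elim: s P => [|v s IH] P.
  rewrite (bigD1 set0) /=; last first.
    by apply/andP; split; apply/forallP => -[].
  rewrite big_pred0 => [|i]; last by rewrite inE.
  rewrite big_pred0 ?addr0 // => S.
  suff -> : S = set0 by rewrite eqxx andbF.
  by apply/setP => -[].
pose up (S : {set 'I_(size s)}) : {set 'I_(size (v :: s))} := lift ord0 @: S.
pose down (S : {set 'I_(size (v :: s))}) : {set 'I_(size s)} := lift ord0 @^-1: S.
have in_up S x : (lift ord0 x \in up S) = (x \in S).
  by rewrite mem_imset //; exact: lift_inj.
have upN S : ord0 \notin up S.
  by apply/negP => /imsetP[x _ /eqP]; rewrite (negPf (neq_lift _ _)).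
have upK S : down (up S) = S by apply/setP => x; rewrite inE in_up.
have forall_up (S : {set 'I_(size s)}) (p : pred 'I_(size (v :: s))) :
    [forall x in up S, p x] = [forall x in S, p (lift ord0 x)].
  apply/forall_inP/forall_inP => H x; first by rewrite -in_up => /H.
  by case/imsetP => y yS ->; exact: H.
have forall_cons (S : {set 'I_(size s)}) (p : pred 'I_(size (v :: s))) :
    [forall x in ord0 |: up S, p x] = p ord0 && [forall x in S, p (lift ord0 x)].
  rewrite -forall_up; apply/forall_inP/andP => [H|[p0 /forall_inP H] x].
    split; first by apply: H; rewrite setU11.
    by apply/forall_inP => x xS; apply: H; rewrite setU1r.
  by case/setU1P => [->|]; last exact: H.
rewrite (bigID (fun S : {set _} => ord0 \notin S)) /=; congr (_ + _).
  rewrite (reindex_onto up down) /=; last first.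
    move=> S /andP[_ S0]; apply/setP => x.
    case: (unliftP ord0 x) => [y ->|->]; first by rewrite in_up inE.
    by rewrite (negPf S0) (negPf (upN _)).
  rewrite -IH; apply: eq_big => [S|S _].
    rewrite upK eqxx upN !andbT !forall_up; congr (_ && _).
    by apply: eq_forallb_in => x xS; rewrite forall_up.
  rewrite [LHS]big_mkcond [RHS]big_mkcond big_ord_recl (negPf (upN _)) Monoid.mul1m /=.
  by apply: eq_bigr => i _; rewrite in_up.
case: ifPn => [Pv|/negPf Pv]; last first.
  rewrite big_pred0 // => S; rewrite negbK; apply/negP => /andP[/andP[_ /forall_inP H] /H].
  by rewrite Pv.
rewrite -IH big_distrr /=.
rewrite (reindex_onto (fun S => ord0 |: up S) down) /=; last first.
  move=> S /andP[_ S0]; rewrite negbK in S0; apply/setP => x.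
  case: (unliftP ord0 x) => [y ->|->]; last by rewrite setU11 S0.
  by rewrite !inE in_up inE eq_sym (negPf (neq_lift _ _)).
apply: eq_big => [S|S _].
  have -> : down (ord0 |: up S) = S.
    by apply/setP => x; rewrite !inE in_up eq_sym (negPf (neq_lift _ _)).
  rewrite eqxx setU11 andbT /= !forall_cons /= e_irr Pv /= andbT.
  apply/andP/andP.
    case=> /andP[/forall_inP H1 /forall_inP H2] /forall_inP H3; split.
      apply/forall_inP => x xS; have := H2 x xS.
      by rewrite forall_cons => /andP[].
    by apply/forall_inP => x xS; rewrite H3 //= H1.
  case=> /forall_inP H1 /forall_inP H2; split; last first.
    by apply/forall_inP => x /H2 /andP[].
  apply/andP; split; apply/forall_inP => x xS; first by case/andP: (H2 x xS).
  rewrite forall_cons /= H1 // andbT e_sym.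
  by case/andP: (H2 x xS).
rewrite [LHS]big_mkcond [in RHS]big_mkcond big_ord_recl setU11 /=; congr (_ * _).
by apply: eq_bigr => i _; rewrite !inE in_up.
Qed.

Variable D : pred T.
Hypothesis comm_f : {in D &, forall v w, ~~ e v w -> f v * f w = f w * f v}.

(** Only products containing both vertices depend on their order: these are absent if the vertices
    are adjacent, and otherwise the two factors commute. *)
Lemma ipoly_swap P v w s : v \in D -> w \in D ->
  ipoly P (v :: w :: s) = ipoly P (w :: v :: s).
Proof.
move=> vD wD /=; rewrite -!addrA; congr (_ + _).
rewrite (e_sym w v); case: (P v); case: (P w); rewrite /= ?addr0 ?add0r //.
case: (boolP (e v w)) => [_|vw] /=; first by rewrite !addr0 addrC.
rewrite !mulrDr addrCA !mulrA (comm_f vD wD vw).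
congr (_ + (_ + _ * _)); apply: eq_ipoly => x.
by rewrite -!andbA; congr (_ && _); rewrite andbC.
Qed.

Lemma ipoly_cat_cons P v s t : v \in D -> all D s ->
  ipoly P (s ++ v :: t) = ipoly P (v :: s ++ t).
Proof.
move=> vD; elim: s P => //= w s IH P /andP[wD sD].
rewrite !IH //; exact: ipoly_swap.
Qed.

(** Allows the vertices to be removed from a graph to be listed first, where [ipoly_cons]
    applies. *)
Lemma perm_ipoly P s t : all D s -> perm_eq s t -> ipoly P s = ipoly P t.
Proof.
elim: s t P => [|v s IH] t P sD st; first by rewrite perm_sym in st; move/perm_nilP: st => ->.
have vt : v \in t by rewrite -(perm_mem st) mem_head.
case/splitPr: vt st => t1 t2 st.
move: st; rewrite perm_sym -[v :: t2]cat1s perm_catCA /= perm_cons perm_sym => st.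
case/andP: sD => vD sD.
rewrite ipoly_cat_cons //=; last first.
  apply/allP => x xt; apply: (allP sD); rewrite (perm_mem st) mem_cat xt //.
by rewrite !(IH _ _ sD st).
Qed.

End IndependencePolynomial.

(** * Vertices of the frustration graphs *)

Definition vtx_code (v : vtx) : nat + nat :=
  match v with VH l => inl l | VB n => inr n end.
Definition vtx_decode (x : nat + nat) : vtx :=
  match x with inl l => VH l | inr n => VB n end.
Lemma vtx_codeK : cancel vtx_code vtx_decode. Proof. by case. Qed.
HB.instance Definition _ := Equality.copy vtx (can_type vtx_codeK).

Lemma VH_inj : injective VH. Proof. by move=> ? ? []. Qed.
Lemma VB_inj : injective VB. Proof. by move=> ? ? []. Qed.

Definition in_verts (j : nat) (v : vtx) : bool :=
  match v with
  | VH l => (1 <= l <= j)%N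
  | VB n => odd n && (5 <= n <= j.+1)%N
  end.

Lemma mem_verts j : verts j =i in_verts j.
Proof.
case=> n; rewrite mem_cat -[in RHS]topredE /=.
  rewrite (mem_map VH_inj) mem_iota orbC.
  by case: mapP => [[] //|_]; rewrite add1n ltnS.
case: mapP => [[] //|_] /=; apply/mapP/idP => [[m]|].
  by rewrite mem_iota => mj [->]; lia.
move=> Hn; exists n./2; first by rewrite mem_iota; lia.
by congr VB; lia.
Qed.

Lemma verts_uniq j : uniq (verts j).
Proof.
rewrite cat_uniq !map_inj_uniq ?iota_uniq //=.
- by rewrite andbT; apply/hasPn => _ /mapP[m _ ->]; apply/negP => /mapP[].
- by move=> m m' [] /double_inj.
- exact: VH_inj.
Qed.

Lemma adj_sym : symmetric adj.
Proof.
case=> i [] l //=; apply/idP/idP; lia.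
Qed.

Lemma adj_irr : irreflexive adj.
Proof. case=> i /=; lia. Qed.

(** * Graph recursion for the transfer matrix *)

Section FrustrationGraph.
Variables (C : fieldType) (A : algType C) (h : nat -> A) (b : nat -> C) (b3 b5 : C).

Local Notation op := (vop h b b3 b5).
Local Notation ip := (ipoly op adj predT).

(** At u = -1 every weight (-u)^k is 1, so the sum over k merely sorts the independent sets by
    size. *)
Lemma TmatN1 j : Tmat h b b3 b5 j (-1) = ip (verts j).
Proof.
rewrite -(ipoly_sum_indep op adj_sym adj_irr (VH 0)).
rewrite /Tmat; set n := size _.
have cardS (S : {set 'I_n}) : (#|S| < n.+1)%N.
  by rewrite ltnS -[X in (_ <= X)%N]card_ord max_card.
rewrite [RHS](partition_big (fun S : {set 'I_n} => Ordinal (cardS S)) predT) //=.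
apply: eq_bigr => i _; rewrite opprK expr1n scale1r /Qch.
apply: eq_bigl => S; rewrite -val_eqE /= /indep /vnth.
by congr (_ && _); rewrite (_ : [forall x in S, true]) ?andbT //; apply/forall_inP.
Qed.

Hypothesis h_ac1 : forall m, h m * h m.+1 = - (h m.+1 * h m).
Hypothesis h_ac2 : forall m, h m * h m.+2 = - (h m.+2 * h m).
Hypothesis h_comm : forall m l, (m + 2 < l)%N -> h m * h l = h l * h m.

Definition anti i l := [|| i + 1 == l, l + 1 == i, i + 2 == l | l + 2 == i]%N.

Lemma h_swap i l : h i * h l = (-1) ^+ anti i l *: (h l * h i).
Proof.
rewrite /anti; wlog il : i l / (i <= l)%N => [W|].
  case/orP: (leq_total i l) => [/W //|/W ->].
  rewrite scalerA -signr_addb (_ : _ (+) _ = false) ?expr0 ?scale1r //.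
  lia.
have [->|->|->|il2] : [\/ l = i, l = i.+1, l = i.+2 | i + 2 < l]%N.
- have : (l == i) || (l == i.+1) || (l == i.+2) || (i + 2 < l)%N by lia.
  by case/orP => [/orP[/orP[]|]|]; [move/eqP; constructor 1|move/eqP; constructor 2|move/eqP; constructor 3| constructor 4].
- by rewrite (_ : [|| _, _, _ | _] = false) ?expr0 ?scale1r //; lia.
- by rewrite (_ : [|| _, _, _ | _] = true) ?expr1 ?scaleN1r //; lia.
- by rewrite (_ : [|| _, _, _ | _] = true) ?expr1 ?scaleN1r //; lia.
- by rewrite (h_comm il2) (_ : [|| _, _, _ | _] = false) ?expr0 ?scale1r //; lia.
Qed.

Lemma h3_swap l i1 i2 i3 :
  h l * (h i1 * h i2 * h i3) =
  (-1) ^+ (anti l i1 (+) anti l i2 (+) anti l i3) *: (h i1 * h i2 * h i3 * h l).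
Proof.
rewrite !signr_addb !mulrA (h_swap l i1) -!scalerAl.
rewrite -(mulrA (h i1) (h l)) (h_swap l i2) -scalerAr -!scalerAl !mulrA.
by rewrite -(mulrA _ (h l)) (h_swap l i3) -!scalerAr !scalerA !mulrA.
Qed.

(** From [5 <= n] on the subtractions in [vop] do not truncate; odd labels put distinct non-adjacent
    composite vertices at least 4 apart. *)
Definition vtx_ok (v : vtx) : bool := if v is VB n then odd n && (5 <= n)%N else true.

(** Moving h_l past a composite vertex gives the parity of the number of its three factors that
    anticommute with h_l, even for non-neighbours. For two composite vertices at least 4 apart, each
    factor of the lower one commutes with the upper one. *)
Lemma vop_comm :
  {in vtx_ok &, forall v w, ~~ adj v w -> op v * op w = op w * op v}.
Proof.
have hb l n : odd n && (5 <= n)%N -> ~~ adj (VH l) (VB n) ->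
    h l * (h (n - 3)%N * h (n - 4)%N * h (n - 1)%N) =
    h (n - 3)%N * h (n - 4)%N * h (n - 1)%N * h l.
  rewrite /= => Hn Hl; rewrite h3_swap (_ : _ (+) _ = false) ?expr0 ?scale1r //.
  rewrite /anti; lia.
have bb n n' : odd n && (5 <= n)%N -> odd n' && (5 <= n')%N -> (n < n')%N ->
    ~~ adj (VB n) (VB n') -> op (VB n) * op (VB n') = op (VB n') * op (VB n).
  move=> Hn Hn' nn' na; have n4 : (n + 4 <= n')%N by move: na => /=; lia.
  rewrite /= -!scalerAl -!scalerAr !scalerA mulrC; congr (_ *: _).
  set t := h (n' - 3)%N * _ * _.
  have ht l : ~~ adj (VH l) (VB n') -> h l * t = t * h l by exact: hb.
  clearbody t.
  rewrite -(mulrA _ _ t) (ht (n - 1)%N) /=; last by lia.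
  rewrite mulrA -(mulrA _ _ t) (ht (n - 4)%N) /=; last by lia.
  by rewrite !mulrA (ht (n - 3)%N) //=; lia.
case=> l [] n; rewrite -!topredE /= => Hl Hn na.
- by rewrite h_swap (_ : anti l n = false) ?expr0 ?scale1r // /anti; apply: negbTE.
- by rewrite -scalerAl -scalerAr hb.
- by rewrite -scalerAl -scalerAr hb.
- case: (ltngtP l n) => [ln|nl|-> //]; first exact: bb.
  by apply/esym/bb => //=; rewrite orbC.
Qed.

Lemma verts_ok j : all vtx_ok (verts j).
Proof. by apply/allP => -[//|n]; rewrite mem_verts -topredE /=; lia. Qed.

Lemma ip_verts j s : uniq s -> s =i verts j -> ip s = ip (verts j).
Proof.
move=> us sj; apply/esym.
apply: (perm_ipoly adj_sym vop_comm _ (verts_ok j)).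
by apply: uniq_perm => //; exact: verts_uniq.
Qed.

Let eqHH i j : (VH i == VH j) = (i == j). Proof. by []. Qed.
Let eqBB i j : (VB i == VB j) = (i == j). Proof. by []. Qed.
Let eqHB i j : (VH i == VB j) = false. Proof. by []. Qed.
Let eqBH i j : (VB i == VH j) = false. Proof. by []. Qed.
Let eqvE := (eqHH, eqBB, eqHB, eqBH).

(** Turns each claim on which vertices survive a removal into linear arithmetic on indices. *)
Ltac verts_lia :=
  try apply: filter_uniq; try exact: verts_uniq;
  first [ by case=> ?; rewrite ?(inE, mem_filter, mem_verts) -?topredE /= ?eqvE; lia
        | by rewrite ?(verts_uniq, cons_uniq) ?filter_uniq ?verts_uniq ?(inE, mem_filter, mem_verts)
             -?topredE /= ?eqvE; lia ].

Lemma ip_verts2 : ip (verts 2) = 1 + h 1%N + h 2%N.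
Proof. by rewrite /verts /= /predT /= !addr0 !mulr1 addrAC. Qed.

Hypothesis h0 : h 0 = 0.

(* For [i = 0] and [i = 1] the truncated indices rely on [h 0 = 0] and on [verts 0] being empty. *)
Lemma ip_verts_rec i :
  ip (verts i.+2.*2) =
    ip (verts i.+1.*2) + h (i.*2.+3) * ip (verts i.*2)
    + h (i.*2.+4) * (ip (verts i.*2) + h (i.*2.+1) * ip (verts i.-1.*2))
    + op (VB (i.*2.+4.+1)) *
      (ip (verts i.*2) - h (i.*2 - 1)%N * ip (verts i.-2.*2)
       + h (i.*2.+2) * ip (verts i.-1.*2)).
Proof.
(* The only possible neighbour of the composite vertex 2i+5 within G_{2i} is h_{2i-1}. *)
pose W := [seq w <- verts i.*2 | w != VH (i.*2 - 1)%N].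
have eW : ip (verts i.*2) = ip W + h (i.*2 - 1)%N * ip (verts i.-2.*2).
  case: (posnP i) => [i0|ipos].
    rewrite i0 h0 mul0r addr0; apply/esym/ip_verts; verts_lia.
  rewrite -(@ip_verts _ (VH (i.*2 - 1) :: W)); [|verts_lia|verts_lia].
  rewrite ipoly_cons (@ip_verts i.-2.*2 (filter _ _)); [by []|verts_lia|verts_lia].
(* Choosing h_{2i+4} leaves the graph of odd size 2i+1, which splitting on h_{2i+1} reduces to even
   sizes. *)
have e1 : ip (verts i.*2.+1) = ip (verts i.*2) + h (i.*2.+1) * ip (verts i.-1.*2).
  rewrite -(@ip_verts _ (VH (i.*2.+1) :: verts i.*2)); [|verts_lia|verts_lia].
  rewrite ipoly_cons (@ip_verts i.-1.*2 (filter _ _)); [by []|verts_lia|verts_lia].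
have e2 : ip (VH (i.*2.+2) :: W) = ip W + h (i.*2.+2) * ip (verts i.-1.*2).
  rewrite ipoly_cons (@ip_verts i.-1.*2 (filter _ _)); [by []|verts_lia|verts_lia].
(* G_{2i+4} is relisted as its final clique followed by G_{2i+2}, and the clique vertices are split
   off one by one. *)
pose s1 := VH (i.*2.+3) :: verts i.+1.*2.
pose s2 := VB (i.*2.+4.+1) :: s1.
rewrite -(@ip_verts _ (VH (i.*2.+4) :: s2)); [|rewrite /s2 /s1; verts_lia|rewrite /s2 /s1; verts_lia].
rewrite ipoly_cons (@ip_verts i.*2.+1 (filter _ _)); [|rewrite /s2 /s1; verts_lia|rewrite /s2 /s1; verts_lia].
rewrite ipoly_cons (_ : ip (filter _ s1) = ip (VH (i.*2.+2) :: W)); last first.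
  apply: (perm_ipoly adj_sym vop_comm).
    by apply/allP => -[//|n]; rewrite ?(inE, mem_filter, mem_verts) -?topredE /= ?eqvE; lia.
  apply: uniq_perm; rewrite /s1; verts_lia.
have -> : ip (verts i.*2) - h (i.*2 - 1)%N * ip (verts i.-2.*2) = ip W.
  by rewrite eW addrK.
rewrite e1 e2 /s1 ipoly_cons (@ip_verts i.*2 (filter _ _)); [|verts_lia|verts_lia].
exact: addrAC.
Qed.

End FrustrationGraph.

(** * Circuit recursion by conjugation through the layers *)

Section Circuit.
Variables (C : fieldType) (A : algType C) (h g : nat -> A) (b c : nat -> C) (k : nat).

Hypothesis h0 : h 0 = 0.
Hypothesis h_sqr : forall m, h m * h m = b m ^+ 2 *: 1.
Hypothesis h_ac1 : forall m, h m * h m.+1 = - (h m.+1 * h m).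
Hypothesis h_ac2 : forall m, h m * h m.+2 = - (h m.+2 * h m).
Hypothesis h_comm : forall m l, (m + 2 < l)%N -> h m * h l = h l * h m.

Hypothesis c0 : c 0 = 1.
Hypothesis c_neq0 : forall j, (1 <= j <= k.*2)%N -> c j != 0.
(** This is sin^2 + cos^2 = 1 for theta_{2j+2}, with the denominator of the sine cleared. *)
Hypothesis c_sqr : forall j, (j < k)%N ->
  c j.+1.*2 ^+ 2 * c j.*2 ^+ 2 = c j.*2 ^+ 2 - b j.+1.*2 ^+ 2.

(* [r j] is [sin (theta j) / b j]. *)
Let r j := if odd j then (c j.-1 * c (j - 2)%N * c j.+1)^-1 else (c (j - 2)%N)^-1.

Lemma r_odd j : r j.*2.+1 = (c j.*2 * c (j.*2 - 1)%N * c j.*2.+2)^-1.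
Proof. by rewrite /r oddS odd_double subn1 subn2. Qed.

Lemma r_even j : r j.*2.+2 = (c j.*2)^-1.
Proof. by rewrite /r !oddS odd_double subn2. Qed.

Hypothesis gate_anti : forall j X, (1 <= j <= k.*2)%N ->
  h j * X = - (X * h j) -> g j * X * g j = c j *: X.
Hypothesis gate_comm : forall j X, (1 <= j <= k.*2)%N ->
  h j * X = X * h j -> g j * X * g j = X * (1 + r j *: h j).

Definition layer j X := g (j.*2 + 2)%N * (g (j.*2 + 1)%N * X * g (j.*2 + 1)%N) * g (j.*2 + 2)%N.

(* The layers are applied innermost (that of highest index) first, as in [V_k = G_k G_k^T]. *)
Fixpoint circ j X := if j is i.+1 then circ i (layer i X) else X.

Lemma layer_linear j a X Y : layer j (a *: X + Y) = a *: layer j X + layer j Y.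
Proof. by rewrite /layer !(mulrDr, mulrDl) -!(scalerAl, scalerAr). Qed.

Lemma circ_linear j a X Y : circ j (a *: X + Y) = a *: circ j X + circ j Y.
Proof. by elim: j X Y => //= j IH X Y; rewrite layer_linear IH. Qed.

Lemma circD j X Y : circ j (X + Y) = circ j X + circ j Y.
Proof. by rewrite -[X]scale1r circ_linear !scale1r. Qed.

Lemma circZ j a X : circ j (a *: X) = a *: circ j X.
Proof.
have c00 : circ j 0 = 0.
  by apply: (addrI (circ j 0)); rewrite -circD !addr0.
by rewrite -[a *: X]addr0 circ_linear c00 addr0.
Qed.

Hypothesis g_comm : forall j X, h j * X = X * h j -> g j * X = X * g j.

(** Each layer is a sandwich, so [X] only has to pass the gates on the left. *)
Lemma circ_pull j X Y : (forall i, (i <= j.*2)%N -> h i * X = X * h i) ->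
  circ j (X * Y) = X * circ j Y.
Proof.
elim: j X Y => //= j IH X Y hX.
rewrite -IH => [|i ij]; last by apply: hX; lia.
congr (circ j _); rewrite /layer !mulrA.
have E1 : g (j.*2 + 2)%N * X = X * g (j.*2 + 2)%N by apply/g_comm/hX; lia.
have E2 : g (j.*2 + 1)%N * X = X * g (j.*2 + 1)%N by apply/g_comm/hX; lia.
by rewrite -(mulrA _ _ X) E2 !mulrA E1.
Qed.

Local Notation V j := (circ j 1).

Lemma h_commE i l : (i + 2 < l)%N || (l + 2 < i)%N || (i == l) -> h i * h l = h l * h i.
Proof.
by case/orP => [/orP[/h_comm//|/h_comm//]|/eqP-> //].
Qed.

Lemma h_antiE i l : [|| i + 1 == l, l + 1 == i, i + 2 == l | l + 2 == i]%N ->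
  h i * h l = - (h l * h i).
Proof.
by case/or4P => /eqP <-; rewrite ?addn1 ?addn2 ?h_ac1 ?h_ac2 ?opprK.
Qed.

Lemma h_comm2 i l m : h i * h l = - (h l * h i) -> h i * h m = - (h m * h i) ->
  h i * (h l * h m) = h l * h m * h i.
Proof. by move=> E1 E2; rewrite mulrA E1 mulNr -(mulrA (h l) (h i)) E2 mulrN opprK mulrA. Qed.

(** h_{2j+1} anticommutes with both generators of the outermost-indexed layer, which yields the two
    cosines, and commutes with all earlier ones. At [j = 0] both indices of [c] are 0. *)
Lemma circ_h_odd j : (j <= k)%N ->
  circ j (h j.*2.+1) = (c j.*2 * c (j.*2 - 1)%N) *: (h j.*2.+1 * V j.-1).
Proof.
case: j => [|j] jk /=; first by rewrite c0 !mulr1 scale1r.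
rewrite -circ_pull; last by move=> i ij; apply: h_commE; lia.
rewrite -circZ; congr circ; rewrite mulr1 /layer.
rewrite (@gate_anti (j.*2 + 1)%N); [|lia|by apply: h_antiE; lia].
rewrite -scalerAr -scalerAl (@gate_anti (j.*2 + 2)%N); [|lia|by apply: h_antiE; lia].
rewrite scalerA mulrC; congr (_ * _ *: _); congr c; lia.
Qed.

(** The layer sends 1 to 1 plus multiples of h_{2j+1} and h_{2j+2}. The constraint on theta_{2j+1}
    makes the total coefficient of h_{2j+1} V_{j-1} equal to 1. *)
Lemma circ_succ j : (j < k)%N ->
  V j.+1 = V j + (c j.*2)^-1 *: circ j (h j.*2.+2) + h j.*2.+1 * V j.-1.
Proof.
move=> jk; rewrite /= /layer.
rewrite (@gate_comm (j.*2 + 1)%N); [|lia|by rewrite mulr1 mul1r].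
rewrite mul1r mulrDr mulrDl (@gate_comm (j.*2 + 2)%N); [|lia|by rewrite mulr1 mul1r].
rewrite mul1r -scalerAr -scalerAl (@gate_anti (j.*2 + 2)%N); [|lia|by apply: h_antiE; lia].
rewrite !circD !circZ !addn1 !addn2 circ_h_odd 1?ltnW //.
have Hc : c j.*2 != 0 by case: (posnP j) => [->|?]; [rewrite c0 oner_eq0|apply: c_neq0; lia].
have Hc1 : c (j.*2 - 1)%N != 0 by case: (posnP j) => [->|?]; [rewrite c0 oner_eq0|apply: c_neq0; lia].
have Hc2 : c j.*2.+2 != 0 by apply: c_neq0; lia.
rewrite r_odd r_even; congr (_ + _ + _); rewrite !scalerA -[RHS]scale1r; congr (_ *: _); field.
by rewrite Hc Hc1 Hc2.
Qed.

(** The upper generator of the next layer anticommutes with both factors, hence commutes with their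
    product and creates a term in itself; the lower one contributes a cosine. *)
Lemma circ_h_pair j : (j <= k)%N ->
  circ j (h j.*2.+1 * h j.*2.+2) =
    c (j.*2 - 1)%N *: (h j.*2.+1 * h j.*2.+2 * (V j - h (j.*2 - 1)%N * V j.-2)).
Proof.
case: j => [|j] jk; first by rewrite /= c0 h0 mul0r subr0 mulr1 scale1r.
(* The difference on the right is what [circ_succ] leaves after its last term cancels: the image of
   1 plus a multiple of h_{2j+2}. *)
rewrite circ_succ // (_ : (j.+1.*2 - 1 = j.*2.+1)%N); last by lia.
rewrite addrK /= -circZ -circD -circ_pull; last first.
  by move=> i ij; rewrite mulrA (@h_commE i) ?mulrA -?mulrA ?(@h_commE i) //; lia.
rewrite -circZ; congr circ; rewrite /layer.
rewrite (@gate_anti (j.*2 + 1)%N); [|lia|]; last first.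
  rewrite mulrA (@h_antiE _ j.*2.+3) ?mulNr -?mulrA ?(@h_commE _ j.*2.+4) //; lia.
rewrite -scalerAr -scalerAl (@gate_comm (j.*2 + 2)%N); [|lia|]; last first.
  by apply: h_comm2; apply: h_antiE; lia.
by rewrite addn1 addn2 r_even.
Qed.

Lemma circ_h_even j : (j.+1 < k)%N ->
  (c j.+1.*2)^-1 *: circ j.+1 (h j.+1.*2.+2) =
   h j.*2.+4 * (V j + h j.*2.+1 * V j.-1)
   + (c j.*2 ^+ 2 * c j.+1.*2 ^+ 2)^-1 *: (h j.*2.+2 * h j.*2.+1 * h j.*2.+4)
     * (V j - h (j.*2 - 1)%N * V j.-2 + h j.*2.+2 * V j.-1).
Proof.
move=> jk.
have Hc : c j.*2 != 0 by case: (posnP j) => [->|?]; [rewrite c0 oner_eq0|apply: c_neq0; lia].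
have Hc1 : c (j.*2 - 1)%N != 0 by case: (posnP j) => [->|?]; [rewrite c0 oner_eq0|apply: c_neq0; lia].
have Hc2 : c j.*2.+2 != 0 by apply: c_neq0; lia.
rewrite !doubleS [circ j.+1 _]/=.
have -> : layer j (h j.*2.+4) = h j.*2.+4 * (c j.*2.+2 *: 1 + r j.*2.+1 *: h j.*2.+1
    + (r j.*2.+1 * r j.*2.+2) *: (h j.*2.+1 * h j.*2.+2)) => [|/=].
  rewrite /layer (@gate_comm (j.*2 + 1)%N); [|lia|by apply: h_commE; lia].
  rewrite mulrDr mulr1 mulrDr mulrDl (@gate_anti (j.*2 + 2)%N); [|lia|by apply: h_antiE; lia].
  rewrite -!scalerAr -scalerAl (@gate_comm (j.*2 + 2)%N); [|lia|].
    rewrite !addn1 !addn2 !mulrDr -!scalerAr !mulr1 scalerDr scalerA addrA.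
    by rewrite !mulrA.
  by apply: h_comm2; apply: h_antiE; lia.
rewrite circ_pull; last by move=> i ij; apply: h_commE; lia.
rewrite !circD !circZ circ_h_odd ?circ_h_pair; [|lia|lia].
set W := V j - h (j.*2 - 1)%N * V j.-2; clearbody W.
(* Two sign changes cancel; the trailing h_{2j+2} can then meet the h_{2j+2} in front of V_{j-1} and
   square to a scalar. *)
have -> : h j.*2.+2 * h j.*2.+1 * h j.*2.+4 = h j.*2.+4 * h j.*2.+1 * h j.*2.+2.
  rewrite -!mulrA (@h_commE j.*2.+1 j.*2.+4); last by lia.
  rewrite mulrA (@h_antiE j.*2.+2 j.*2.+4); last by lia.
  by rewrite mulNr -mulrA (@h_antiE j.*2.+2 j.*2.+1) ?mulrN ?opprK //; lia.
set a := h j.*2.+4; set x := h j.*2.+1; set y := h j.*2.+2; set Z := V j.-1.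
rewrite !mulrDr -!scalerAl -!scalerAr !scalerDr !scalerA mulVf // scale1r.
rewrite -!addrA; congr (_ + _); rewrite !mulrA.
have -> : a * x * y * y = b j.*2.+2 ^+ 2 *: (a * x) by rewrite -mulrA h_sqr -scalerAr mulr1.
rewrite -!scalerAl [RHS]addrCA addrC; congr (_ + _).
  congr (_ *: _); rewrite r_odd r_even.
  by field; rewrite Hc Hc1 Hc2.
rewrite -[X in _ = X + _]scale1r scalerA -scalerDl; congr (_ *: _).
(* The direct term and the squared one must add up to the circuit coefficient 1 / c_{2j+2}^2 of
   h_{2j+4} h_{2j+1} V_{j-1}. *)
have -> : b j.*2.+2 ^+ 2 = c j.*2 ^+ 2 - c j.*2.+2 ^+ 2 * c j.*2 ^+ 2.
  by rewrite (@c_sqr j) ?subKr //; lia.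
rewrite r_odd.
by field; rewrite Hc Hc1 Hc2.
Qed.

Lemma circ_rec j : (j.+1 < k)%N ->
  V j.+2 = V j.+1 + h j.*2.+3 * V j + h j.*2.+4 * (V j + h j.*2.+1 * V j.-1)
   + (c j.*2 ^+ 2 * c j.+1.*2 ^+ 2)^-1 *: (h j.*2.+2 * h j.*2.+1 * h j.*2.+4)
     * (V j - h (j.*2 - 1)%N * V j.-2 + h j.*2.+2 * V j.-1).
Proof. by move=> jk; rewrite circ_succ // addrAC circ_h_even // addrA. Qed.

End Circuit.

From mathcomp Require Import all_classical all_reals all_analysis.
From mathcomp Require Import complex.

(** * Trigonometric identities for complex angles *)

Section ComplexTrig.
Variable R : realType.
Implicit Types x y z : R[i].

Lemma CexpD x y : Cexp (x + y) = Cexp x * Cexp y.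
Proof.
case: x y => [a b] [c d]; rewrite /Cexp /= expRD cosD sinD.
by apply/eqP; rewrite eq_complex /=; apply/andP; split; apply/eqP; ring.
Qed.

Lemma Cexp0 : Cexp (0 : R[i]) = 1.
Proof.
rewrite /Cexp /= expR0 cos0 sin0.
by apply/eqP; rewrite eq_complex /=; apply/andP; split; apply/eqP; ring.
Qed.

Lemma CexpN x : Cexp (- x) * Cexp x = 1.
Proof. by rewrite -CexpD addNr Cexp0. Qed.

Lemma Ccos0 : Ccos (0 : R[i]) = 1.
Proof. by rewrite /Ccos mulr0 oppr0 Cexp0; field. Qed.

Let sqi : 'i%C * 'i%C = -1 :> R[i].
Proof. by rewrite -expr2 sqr_i. Qed.

Lemma i_neq0 : 'i%C != 0 :> R[i].
Proof. by apply/eqP => h; move: sqi; rewrite h mul0r => /esym/eqP; rewrite oppr_eq0 oner_eq0. Qed.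

Lemma Csqr_add x : Ccos x ^+ 2 + Csin x ^+ 2 = 1.
Proof.
have E := CexpN ('i%C * x); have I := sqi; have n := i_neq0.
rewrite /Ccos /Csin; set u := Cexp (- _) in E *; set v := Cexp _ in E *.
move: u v ('i%C : R[i]) E I n => u v i E I n.
(* Isolates [u * v] and [i * i], whose values 1 and -1 are then substituted. *)
have -> : ((v + u) / 2) ^+ 2 + ((v - u) / (2 * i)) ^+ 2
   = u * v - (1 + (i * i)) * (v-u)^+2 / (4 * (i * i)) * -1.
  by field.
by rewrite E I; field.
Qed.

Lemma Ccos_half x : Ccos x = Ccos (x / 2) ^+ 2 - Csin (x / 2) ^+ 2.
Proof.
have I := sqi; have n := i_neq0; rewrite /Ccos /Csin.
have -> : Cexp ('i%C * x) = Cexp ('i%C * (x / 2)) ^+ 2.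
  by rewrite expr2 -CexpD; congr Cexp; field.
have -> : Cexp (- ('i%C * x)) = Cexp (- ('i%C * (x / 2))) ^+ 2.
  by rewrite expr2 -CexpD; congr Cexp; field.
set u := Cexp (- _); set v := Cexp _.
move: u v ('i%C : R[i]) I n => v u i I n.
have -> : ((u + v) / 2) ^+ 2 - ((u - v) / (2 * i)) ^+ 2
   = ((u + v) / 2) ^+ 2 - (u - v) ^+ 2 / (4 * (i * i)) by field.
by rewrite I; field.
Qed.

Lemma Csin_half x : Csin x = 2 * Csin (x / 2) * Ccos (x / 2).
Proof.
have n := i_neq0; rewrite /Ccos /Csin.
have -> : Cexp ('i%C * x) = Cexp ('i%C * (x / 2)) ^+ 2.
  by rewrite expr2 -CexpD; congr Cexp; field.
have -> : Cexp (- ('i%C * x)) = Cexp (- ('i%C * (x / 2))) ^+ 2.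
  by rewrite expr2 -CexpD; congr Cexp; field.
by field.
Qed.

End ComplexTrig.

(** * Closed form of the couplings *)

Section Couplings.
Variables (C : fieldType) (b c : nat -> C) (k : nat).

Hypothesis c0 : c 0 = 1.
Hypothesis c_neq0 : forall j, (1 <= j <= k.*2)%N -> c j != 0.
Hypothesis c_sqr : forall j, (j < k)%N ->
  c j.+1.*2 ^+ 2 * c j.*2 ^+ 2 = c j.*2 ^+ 2 - b j.+1.*2 ^+ 2.

(** Once [c_sqr] eliminates the b_j, the initial denominators become c_2^2 and c_2^2 c_4^2, and each
    later one a quotient of two squared cosines that shifts the closed form by one index. *)
Lemma betamE m : (m.+1 < k)%N ->
  betam b (1 - b 2%N ^+ 2)^-1 (1 - b 2%N ^+ 2 - b 4%N ^+ 2)^-1 m.+1 =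
    (c m.*2 ^+ 2 * c m.+1.*2 ^+ 2)^-1.
Proof.
have b_sqr j : (j < k)%N ->
    b j.+1.*2 ^+ 2 = c j.*2 ^+ 2 - c j.+1.*2 ^+ 2 * c j.*2 ^+ 2.
  by move=> /c_sqr ->; rewrite subKr.
have c_even j : (j <= k)%N -> c j.*2 != 0.
  by case: j => [|j] jk; [rewrite c0 oner_eq0 | apply: c_neq0; lia].
elim/ltn_ind: m => -[|[|p]] IH mk.
- rewrite /= -[2%N]/(1.*2) b_sqr; last by lia.
  by rewrite c0 expr1n mulr1 subKr mul1r.
- rewrite /= -[2%N]/(1.*2) -[4%N]/(2.*2) !b_sqr; [|lia|lia].
  by rewrite c0 expr1n mulr1 subKr mulrC subKr.
rewrite [betam _ _ _ _]/= -/(betam b _ _ p.+2) -/(betam b _ _ p.+1).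
rewrite !IH; [|lia|lia|lia|lia].
have -> : (p.+3.*2 - 4 = p.+1.*2)%N by lia.
rewrite !b_sqr; [|lia|lia].
have n0 : c p.*2 != 0 by apply: c_even; lia.
have n1 : c p.+1.*2 != 0 by apply: c_even; lia.
have n2 : c p.+2.*2 != 0 by apply: c_even; lia.
have n3 : c p.+3.*2 != 0 by apply: c_even; lia.
set D := (X in _ / X).
have -> : D = c p.+3.*2 ^+ 2 / c p.+1.*2 ^+ 2.
  by rewrite /D; field; rewrite n0 n1 n2.
by field; rewrite n1 n2 n3.
Qed.

End Couplings.

(** * Conjugation by a single gate *)

Section Gates.
Variables (R : realType) (A : algType R[i]) (h : nat -> A) (b theta : nat -> R[i]).
Hypothesis h_sqr : forall m, h m * h m = b m ^+ 2 *: 1.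

Local Notation gate := (gate h b theta).

Lemma gate_commute j (X : A) : h j * X = X * h j -> gate j * X = X * gate j.
Proof.
by move=> E; rewrite mulrDl mulrDr -!(scalerAl, scalerAr) mul1r mulr1 E.
Qed.

Lemma gate_sinE j q : b j != 0 ->
  ((q / b j) *: h j) * ((q / b j) *: h j) = q ^+ 2 *: 1.
Proof.
move=> bj; rewrite -scalerAl -scalerAr h_sqr !scalerA; congr (_ *: _).
by field.
Qed.

(** With p the half-angle cosine and H the sine part, (p + H) X (p + H) = (p^2 - H^2) X, and H^2 is
    the squared half-angle sine. *)
Lemma gate_conj_anti j (X : A) : b j != 0 -> h j * X = - (X * h j) ->
  gate j * X * gate j = Ccos (theta j) *: X.
Proof.
move=> bj E; rewrite (Ccos_half (theta j)) /Defs.gate.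
have := gate_sinE (Csin (theta j / 2)) bj.
set p := Ccos _; set q := Csin _; set H := (q / b j) *: h j => HH.
have EH : H * X = - (X * H) by rewrite -scalerAl -scalerAr E scalerN.
clearbody H; rewrite mulrDl EH -scalerAl mul1r mulrDl !mulrDr !mulNr -(mulrA X H H) HH.
by rewrite -!scalerAr -!scalerAl !mulr1 scalerA -expr2 scalerBl addrA addrK.
Qed.

Lemma gate_conj_comm j (X : A) : b j != 0 -> h j * X = X * h j ->
  gate j * X * gate j = X * (1 + (Csin (theta j) / b j) *: h j).
Proof.
move=> bj /gate_commute ->; rewrite -mulrA; congr (_ * _).
rewrite -[X in X + _]scale1r -[X in X *: _ + _](Csqr_add (theta j / 2)).
rewrite (Csin_half (theta j)) /Defs.gate.
have := gate_sinE (Csin (theta j / 2)) bj.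
set p := Ccos _; set q := Csin _; set H := (q / b j) *: h j => HH.
have -> : (2 * q * p / b j) *: h j = p *: H + p *: H.
  by rewrite !scalerA -scalerDl; congr (_ *: _); ring.
clearbody H; rewrite mulrDl !mulrDr HH -!scalerAl -!scalerAr !mulr1 mul1r scalerA -expr2 scalerDl.
by rewrite -!addrA; congr (_ + _); rewrite addrA addrC.
Qed.

(** The top layer is last in [Gcirc] and first in [GcircT], so the two products are peeled at
    opposite ends. *)
Lemma circ_gate k X : circ gate k X = Gcirc h b theta k * X * GcircT h b theta k.
Proof.
elim: k X => [|k IH] X /=; first by rewrite /Gcirc /GcircT !big_ord0 mul1r mulr1.
rewrite IH /Gcirc /GcircT big_ord_recr /= big_ord_recl /= subn0 /layer !mulrA.
have -> : (k.+1.*2 - 1 = k.*2 + 1)%N by lia.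
have -> : (k.+1.*2 = k.*2 + 2)%N by lia.
by congr (_ * _); apply: eq_bigr => i _; rewrite subSS.
Qed.

End Gates.

(** * Matching the graph and circuit recursions *)

Theorem mainTheorem12 (R : realType) (A : algType R[i]) (k : nat)
  (h : nat -> A) (b : nat -> R[i]) (theta : nat -> R[i]) :
  (0 < k)%N ->
  (* the model of size M = 2k: h_j = 0, b_j = 0 outside 1..M *)
  (forall j, (j == 0)%N || (k.*2 < j)%N -> h j = 0 /\ b j = 0) ->
  (forall m, h m * h m = b m ^+ 2 *: 1) ->
  (forall m, h m * h m.+1 = - (h m.+1 * h m)) ->
  (forall m, h m * h m.+2 = - (h m.+2 * h m)) ->
  (forall m l, (m + 2 < l)%N -> h m * h l = h l * h m) ->
  (forall j, (1 <= j <= k.*2)%N -> b j != 0) ->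
  (* angles, with theta_0 = theta_{-1} = 0 (index 2j-3 truncates to 0 for j = 1) *)
  theta 0 = 0 ->
  (forall j, (1 <= j <= k.*2)%N -> Ccos (theta j) != 0) ->
  (forall j, (1 <= j <= k)%N ->
     Csin (theta j.*2) = b j.*2 / Ccos (theta (j.*2 - 2)%N)) ->
  (forall j, (1 <= j <= k)%N ->
     Csin (theta (j.*2 - 1)%N) =
       b (j.*2 - 1)%N / (Ccos (theta (j.*2 - 2)%N) * Ccos (theta (j.*2 - 3)%N)
                       * Ccos (theta j.*2))) ->
  (* standing assumption: denominators of the beta recursion are nonzero *)
  let b3 := (1 - b 2%N ^+ 2)^-1 in
  let b5 := (1 - b 2%N ^+ 2 - b 4%N ^+ 2)^-1 in
  (forall m, (3 <= m < k)%N ->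
     b (m.*2 - 4)%N ^+ 2 * betam b b3 b5 (m - 2)%N - b m.*2 ^+ 2 * betam b b3 b5 m.-1 + 1
       != 0) ->
  (forall j, (2 <= j <= k)%N ->
     beta b b3 b5 (j.*2 - 1)%N =
       (Ccos (theta (j.*2 - 4)%N) ^+ 2 * Ccos (theta (j.*2 - 2)%N) ^+ 2)^-1)
  /\ Tmat h b b3 b5 k.*2 (-1) = Vcirc h b theta k.
Proof.
move=> k_gt0 h_out h_sqr h_ac1 h_ac2 h_comm b_neq0 th0 c_neq0 sin_even sin_odd b3 b5 _.
pose c j := Ccos (theta j).
have h0 : h 0 = 0 by case: (h_out 0).
have c0 : c 0 = 1 by rewrite /c th0 Ccos0.
have c_sqr j : (j < k)%N -> c j.+1.*2 ^+ 2 * c j.*2 ^+ 2 = c j.*2 ^+ 2 - b j.+1.*2 ^+ 2.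
  move=> jk; have := sin_even j.+1; rewrite (_ : (j.+1.*2 - 2 = j.*2)%N); last by lia.
  move=> /(_ jk) E; have := Csqr_add (theta j.+1.*2); rewrite E => /(canRL (addrK _)) E2.
  have n : c j.*2 != 0.
    by case: (posnP j) => [->|?]; [rewrite c0 oner_eq0 | apply: c_neq0; lia].
  by rewrite {1}/c E2 -/(c _); field.
have betaE j : (2 <= j <= k)%N ->
    beta b b3 b5 (j.*2 - 1)%N = (c (j.*2 - 4)%N ^+ 2 * c (j.*2 - 2)%N ^+ 2)^-1.
  case: j => [|[|m]] // mk; rewrite /beta (_ : (m.+2.*2 - 1)./2 = m.+1)%N; last by lia.
  rewrite (betamE c0 c_neq0 c_sqr) //; congr (c _ ^+ 2 * c _ ^+ 2)^-1; lia.
split; first exact: betaE.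
pose g := gate h b theta.
pose r j := if odd j then (c j.-1 * c (j - 2)%N * c j.+1)^-1 else (c (j - 2)%N)^-1.
(* The factor b_j in the constraint cancels the normalisation of h_j in the gate, leaving cosines
   only. *)
have rE j : (1 <= j <= k.*2)%N -> Csin (theta j) / b j = r j.
  move=> jk; have bj := b_neq0 j jk; rewrite /r; case: ifP => oj.
    have := sin_odd j.+1./2; have -> : (j.+1./2.*2 - 1 = j)%N by lia.
    have -> : (j.+1./2.*2 - 2 = j.-1)%N by lia.
    have -> : (j.+1./2.*2 - 3 = j - 2)%N by lia.
    have -> : (j.+1./2.*2 = j.+1)%N by lia.
    move=> ->; last by lia.
    by rewrite mulrAC mulfV // mul1r.
  have := sin_even j./2; have -> : (j./2.*2 = j)%N by lia.
  by move=> ->; [rewrite mulrAC mulfV // mul1r | lia].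
have g_conj_anti j X : (1 <= j <= k.*2)%N ->
    h j * X = - (X * h j) -> g j * X * g j = c j *: X.
  by move=> /b_neq0; exact: gate_conj_anti.
have g_conj_comm j X : (1 <= j <= k.*2)%N ->
    h j * X = X * h j -> g j * X * g j = X * (1 + r j *: h j).
  by move=> jk; rewrite -rE //; apply/gate_conj_comm/b_neq0.
have g_comm j X : h j * X = X * h j -> g j * X = X * g j by exact: gate_commute.
rewrite TmatN1 -[Vcirc _ _ _ _](_ : circ g k 1 = _); last by rewrite circ_gate mulr1.
suff E j : (j <= k)%N -> ipoly (vop h b b3 b5) adj predT (verts j.*2) = circ g j 1.
  exact: E.
(* The recursion reaches back up to four values of [j] with truncated predecessors, so only [j = 0]
   and [j = 1] need a direct check. *)
elim/ltn_ind: j => -[|[|j]] IH jk.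
- by [].
- rewrite ip_verts2.
  rewrite (circ_succ h_ac1 h_ac2 h_comm c0 c_neq0 g_conj_anti g_conj_comm g_comm) //=.
  by rewrite c0 invr1 scale1r mulr1 addrAC.
rewrite (ip_verts_rec b b3 b5 h_ac1 h_ac2 h_comm h0) !IH; [|lia..].
rewrite (circ_rec h0 h_sqr h_ac1 h_ac2 h_comm c0 c_neq0 c_sqr g_conj_anti g_conj_comm g_comm) //.
(* Both recursions now agree up to the coefficient of the composite vertex, beta_{2j+3}, which
   [betaE] identifies with the circuit's cosine factor. *)
congr (_ + _ * _); rewrite /vop; congr (_ *: (h _ * h _ * h _)); try lia.
have -> : (j.*2.+1.+4 - 2 = j.+2.*2 - 1)%N by lia.
rewrite betaE; last by lia.
congr (c _ ^+ 2 * c _ ^+ 2)^-1; lia.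
Qed.
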